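(* Let $I$ be a finite nonempty index set and let $\{f_i\mid i\in I\}$ be a family of positive-valued continuous functions defined on $\mathbb{R}^n$, with corresponding equidistant functions $\{G_i\mid i\in I\}$. If $G_{\min}$ is the equidistant function belonging to the function $$f_{\min}\colon\mathbb{R}^n\to\mathbb{R},\qquad f_{\min}(x)=\min\{f_i(x)\mid i\in I\},$$ then $$G_{\min}(x)=\min\{G_i(x)\mid i\in I\}$$ for any $x\in\mathbb{R}^n$.
   Context: $\mathbb{R}^{n+1}$ carries the Euclidean distance $d$, and $d(p,S)=\inf\{d(p,q)\mid q\in S\}$ for a point $p$ and a set $S$. For a positive-valued continuous function $f\colon\mathbb{R}^n\to\mathbb{R}^+$ let $K=\mathbb{R}^n\times\{0\}\subset\mathbb{R}^{n+1}$ and $L=\{(t,f(t))\mid t\in\mathbb{R}^n\}\subset\mathbb{R}^{n+1}$. For each $x\in\mathbb{R}^n$ there is a unique positive real number $G(x)$ with $d((x,G(x)),L)=d((x,G(x)),K)$; the resulting function $G\colon\mathbb{R}^n\to\mathbb{R}^+$, whose graph is the equidistant set $\{p\in\mathbb{R}^{n+1}\mid d(p,K)=d(p,L)\}$, is called the equidistant function belonging (corresponding) to $f$. *)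

(* Defs.v *)
From HB Require Import structures.
From mathcomp Require Export all_boot all_order all_algebra.
From mathcomp Require Export all_classical all_reals all_analysis.

Set Implicit Arguments.
Unset Strict Implicit.
Unset Printing Implicit Defensive.

Export Order.TTheory GRing.Theory Num.Theory.
Export numFieldNormedType.Exports.

Local Open Scope classical_set_scope.
Local Open Scope ring_scope.

(* The library norm on row vectors is the sup norm, so the Euclidean distance
   is written out.  The topology of 'rV[R]_n, used for continuity, is the same
   for both. *)
Definition euclid_dist (R : realType) (m : nat) (p q : 'rV[R]_m) : R :=
  Num.sqrt (\sum_(k < m) (p 0 k - q 0 k) ^+ 2).

(* For nonempty S this is the usual infimum; inf set0 = 0. *)
Definition dist_to_set (R : realType) (m : nat) (p : 'rV[R]_m)
    (S : set 'rV[R]_m) : R :=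
  inf [set euclid_dist p q | q in S].

Definition graph_point (R : realType) (n : nat) (t : 'rV[R]_n) (y : R) :
    'rV[R]_(n + 1) :=
  row_mx t (const_mx y).

Definition horizontal (R : realType) (n : nat) : set 'rV[R]_(n + 1) :=
  [set graph_point t 0 | t in [set: 'rV[R]_n]].

Definition graph_of (R : realType) (n : nat) (f : 'rV[R]_n -> R) :
    set 'rV[R]_(n + 1) :=
  [set graph_point t (f t) | t in [set: 'rV[R]_n]].

(* Meant for f continuous and positive-valued, where exactly one y > 0
   satisfies the equation for each x; 0 is only the default returned by xget
   when no such y exists. *)
Definition equidistant_function (R : realType) (n : nat) (f : 'rV[R]_n -> R)
    (x : 'rV[R]_n) : R :=
  xget 0 [set y : R | 0 < y /\
    dist_to_set (graph_point x y) (graph_of f)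
      = dist_to_set (graph_point x y) (@horizontal R n)].

(* Main.v *)
(* For [y > 0] the point [(x, y)] is at distance [y] from the hyperplane, so it
   is at least as close to the hyperplane as to the graph of [f] iff the open
   ball of radius [y] around it avoids the graph.  The equidistant function of
   [f] at [x] is therefore the largest [y] with this property.  If [f <= g],
   the ball for [f] also avoids the graph of [g]: were [(t, g t)] inside it,
   then [f t] would lie under the ball while [f x] lies over it, and by the
   intermediate value theorem the graph of [f] would cross the horizontal disc
   of radius [y] around [(x, y)].  So the equidistant function is monotone in
   [f]; that it commutes with minima follows because at each [t] the value
   [f_min t] is one of the [f_i t]. *)

Require Import Defs.
From mathcomp Require Import ring lra.

Set Implicit Arguments.
Unset Strict Implicit.
Unset Printing Implicit Defensive.

Local Open Scope classical_set_scope.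
Local Open Scope ring_scope.

Definition sqdist (R : realType) (n : nat) (x t : 'rV[R]_n) : R :=
  \sum_(k < n) (x 0 k - t 0 k) ^+ 2.

Definition ball_avoids_graph (R : realType) (n : nat) (f : 'rV[R]_n -> R)
    (x : 'rV[R]_n) (y : R) : Prop :=
  forall t, y ^+ 2 <= sqdist x t + (y - f t) ^+ 2.

Section Equidistant.
Variables (R : realType) (n : nat).
Implicit Types (f g : 'rV[R]_n -> R) (x t : 'rV[R]_n) (y z : R).

Lemma sqdist_ge0 x t : 0 <= sqdist x t.
Proof. by apply: sumr_ge0 => k _; exact: sqr_ge0. Qed.

Lemma sqdistxx x : sqdist x x = 0.
Proof. by apply: big1 => k _; rewrite subrr expr0n. Qed.

Lemma euclid_dist_ge0 m (p q : 'rV[R]_m) : 0 <= euclid_dist p q.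
Proof. exact: sqrtr_ge0. Qed.

Lemma dist_to_set_le m (p q : 'rV[R]_m) (S : set 'rV[R]_m) :
  S q -> dist_to_set p S <= euclid_dist p q.
Proof.
move=> Sq; apply: ge_inf; last by exists q.
by exists 0 => _ [r _ <-]; exact: euclid_dist_ge0.
Qed.

Lemma le_dist_to_set m (p : 'rV[R]_m) (S : set 'rV[R]_m) (z : R) :
  S !=set0 -> (forall q, S q -> z <= euclid_dist p q) -> z <= dist_to_set p S.
Proof.
move=> [q Sq] zS; apply: lb_le_inf; first by exists (euclid_dist p q), q.
by move=> _ [r Sr <-]; exact: zS.
Qed.

Lemma euclid_dist_graph_point x t y z :
  euclid_dist (graph_point x y) (graph_point t z)
  = Num.sqrt (sqdist x t + (y - z) ^+ 2).
Proof.
rewrite /euclid_dist /graph_point big_split_ord /= big_ord1 /sqdist.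
congr (Num.sqrt (_ + _)); last by rewrite !row_mxEr !mxE.
by apply: eq_bigr => k _; rewrite !row_mxEl.
Qed.

Lemma dist_horizontal x y :
  0 <= y -> dist_to_set (graph_point x y) (@horizontal R n) = y.
Proof.
move=> y0; apply/eqP; rewrite eq_le; apply/andP; split.
  apply: le_trans (dist_to_set_le _ (q := graph_point x 0) _) _.
    by exists x.
  by rewrite euclid_dist_graph_point sqdistxx add0r subr0 sqrtr_sqr ger0_norm.
apply: le_dist_to_set; first by exists (graph_point x 0), x.
move=> _ [t _ <-]; rewrite euclid_dist_graph_point subr0.
rewrite -{1}(ger0_norm y0) -sqrtr_sqr ler_wsqrtr //.
by rewrite lerDr sqdist_ge0.
Qed.

Lemma le_dist_graph f x y z : 0 <= z ->
  (z <= dist_to_set (graph_point x y) (graph_of f)) <->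
  (forall t, z ^+ 2 <= sqdist x t + (y - f t) ^+ 2).
Proof.
move=> z0; have le_sqrt t : (z ^+ 2 <= sqdist x t + (y - f t) ^+ 2)
    = (z <= euclid_dist (graph_point x y) (graph_point t (f t))).
  rewrite euclid_dist_graph_point -{2}(ger0_norm z0) -sqrtr_sqr ler_sqrt //.
  by rewrite addr_ge0 ?sqdist_ge0 ?sqr_ge0.
split=> [zD t|zq].
  rewrite le_sqrt; apply: le_trans zD (dist_to_set_le _ _).
  by exists t.
apply: le_dist_to_set; first by exists (graph_point x (f x)), x.
by move=> _ [t _ <-]; rewrite -le_sqrt.
Qed.

(** Cancelling [y ^+ 2] leaves a condition linear in [y], from which the dependence on the radius
    can be read off. *)
Lemma ball_avoids_graphE f x y :
  ball_avoids_graph f x y <-> forall t, 2 * y * f t <= sqdist x t + f t ^+ 2.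
Proof. by split=> H t; have := H t; rewrite -subr_ge0 => ?; nra. Qed.

Lemma near_sqdist x (P : set 'rV[R]_n) : (\forall t \near x, P t) ->
  exists2 d : R, 0 < d & forall t, sqdist x t < d ^+ 2 -> P t.
Proof.
move=> /nbhs_ballP [d /= d0 dP]; exists d => // t qt; apply: dP.
split=> // i j; rewrite (ord1 i); change (`|x 0 j - t 0 j| < d).
rewrite -(@ltr_pXn2r _ 2) ?nnegrE ?normr_ge0 ?(ltW d0) //.
rewrite real_normK ?num_real //.
(* Each coordinate is bounded by the Euclidean norm, so the Euclidean ball lies in the sup-norm
   ball. *)
apply: le_lt_trans qt; rewrite /sqdist (bigD1 j) //= lerDl.
by apply: sumr_ge0 => k _; exact: sqr_ge0.
Qed.

(** Although [f] may tend to 0 far away, low points of its graph stay horizontally away from [x]. *)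
Lemma continuous_pos_lower_bound f x : 0 < f x -> {for x, continuous f} ->
  exists c d : R, [/\ 0 < c, 0 < d & forall t, f t < c -> d ^+ 2 <= sqdist x t].
Proof.
move=> fx fc; have fx2 : f x / 2 < f x by lra.
have [d d0 dP] := near_sqdist (cvgr_gt _ fc _ fx2).
exists (f x / 2), d; split=> // [|t ft]; first by rewrite divr_gt0.
rewrite leNgt; apply/negP => /dP /=; lra.
Qed.

Section Fixed.
Variables (f : 'rV[R]_n -> R) (x : 'rV[R]_n).
Hypotheses (f_pos : forall t, 0 < f t) (f_cont : {for x, continuous f}).

(** The gap [e] in squared distance is uniform in [t]: where [f t >= b], the larger radius [z]
    leaves [2 * (z - y) * b]; where [f t < b], the point is far from [x] and [d ^+ 2 / 2]
    remains. *)
Lemma dist_graph_gt y z : 0 < y -> y < z -> ball_avoids_graph f x z ->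
  y < dist_to_set (graph_point x y) (graph_of f).
Proof.
move=> y0 yz /ball_avoids_graphE zP.
have [c [d [c0 d0 cd]]] := continuous_pos_lower_bound (f_pos x) f_cont.
pose b := Num.min c (d ^+ 2 / (4 * y)).
have d20 : 0 < d ^+ 2 by rewrite exprn_gt0.
have b0 : 0 < b by rewrite lt_min c0 divr_gt0 // mulr_gt0.
have by4 : 4 * y * b <= d ^+ 2.
  by rewrite -ler_pdivlMl ?mulr_gt0 // mulrC ge_min lexx orbT.
pose e := Num.min (d ^+ 2 / 2) (2 * (z - y) * b).
have e0 : 0 < e by rewrite lt_min divr_gt0 // !mulr_gt0 // subr_gt0.
have e1 : e <= d ^+ 2 / 2 by rewrite ge_min lexx.
have e2 : e <= 2 * (z - y) * b by rewrite ge_min lexx orbT.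
apply: (@lt_le_trans _ _ (Num.sqrt (y ^+ 2 + e))).
  by rewrite -{1}(ger0_norm (ltW y0)) -sqrtr_sqr ltr_sqrt ?ltrDl //
    addr_gt0 ?exprn_gt0.
apply/le_dist_graph; first exact: sqrtr_ge0.
move=> t; rewrite sqr_sqrtr; last by rewrite addr_ge0 ?sqr_ge0 ?ltW.
have [ft|ft] := ltP (f t) b.
  have /cd : f t < c by apply: lt_le_trans ft _; rewrite ge_min lexx.
  have := f_pos t; nra.
have := zP t; nra.
Qed.

Lemma ball_avoids_graph_small :
  exists2 y : R, 0 < y & ball_avoids_graph f x y.
Proof.
have [c [d [c0 d0 cd]]] := continuous_pos_lower_bound (f_pos x) f_cont.
(* The bound [c / 2] serves the points with [f t >= c]; for the others,
   [2 * d * f t <= d ^+ 2 + f t ^+ 2]. *)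
exists (Num.min (c / 2) d); first by rewrite lt_min d0 divr_gt0.
apply/ball_avoids_graphE => t; set y := Num.min _ _.
have y1 : y <= c / 2 by rewrite ge_min lexx.
have y2 : y <= d by rewrite ge_min lexx orbT.
have ft0 := f_pos t; have qt0 := sqdist_ge0 x t.
have [/cd qt|ft] := ltP (f t) c; last by nra.
have := sqr_ge0 (d - f t); nra.
Qed.

(** The witness is the infimum of the heights [h t] below: it is positive by the previous lemma, and
    almost minimal [t] show that the graph is no farther than the hyperplane. *)
Lemma equidistant_point_exists : exists y, 0 < y /\
  dist_to_set (graph_point x y) (graph_of f)
    = dist_to_set (graph_point x y) (@horizontal R n).
Proof.
have [y0 y00 /ball_avoids_graphE y0P] := ball_avoids_graph_small.
(* [h t] is the height at which [(x, h t)] is as far from [(t, f t)] as from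
   the hyperplane. *)
pose h t := (sqdist x t + f t ^+ 2) / (2 * f t).
have hE t : sqdist x t + f t ^+ 2 = 2 * h t * f t.
  rewrite /h; have := f_pos t; move=> ?; field; lra.
have y0h t : y0 <= h t.
  by have := y0P t; have := f_pos t;
    rewrite hE -mulrA (mulrC y0) mulrA => ?; nra.
pose S := [set h t | t in [set: 'rV[R]_n]].
have Sinf : has_inf S.
  by split; [exists (h x), x | exists y0 => _ [t _ <-]].
pose y := inf S.
have yh t : y <= h t by apply: ge_inf; [exact: Sinf.2 | exists t].
have yy0 : y0 <= y by apply: lb_le_inf; [exact: Sinf.1 | move=> _ [t _ <-]].
have ypos : 0 < y by lra.
exists y; split=> //; rewrite dist_horizontal ?ltW //.
apply/eqP; rewrite eq_le; apply/andP; split; last first.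
  apply/le_dist_graph; rewrite ?ltW // -/(ball_avoids_graph f x y).
  apply/ball_avoids_graphE => t; rewrite hE.
  by have := f_pos t; have := yh t => ? ?; nra.
set D := dist_to_set _ _; rewrite leNgt; apply/negP => yD.
have D0 : 0 < D by exact: lt_trans ypos yD.
have /(le_dist_graph f x y (ltW D0)) DP : D <= D by [].
(* A point with [h t < y + eps] has [f t <= 2 * h t] bounded, so its squared
   distance to [(x, y)] exceeds [y ^+ 2] by less than [D ^+ 2 - y ^+ 2]. *)
pose g := D ^+ 2 - y ^+ 2.
have g0 : 0 < g by rewrite subr_gt0 ltr_pXn2r ?nnegrE ?ltW.
(* With [f t <= 4 * y] and [h t - y < e], the excess [2 * f t * (h t - y)] is below
   [8 * y * e <= g / 2]. *)
pose e := Num.min y (g / (16 * y)).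
have e0 : 0 < e by rewrite lt_min ypos divr_gt0 // mulr_gt0.
have e1 : e <= y by rewrite ge_min lexx.
have e2 : 16 * y * e <= g.
  by rewrite -ler_pdivlMl ?mulr_gt0 // mulrC ge_min lexx orbT.
have [_ [t _ <-] hte] := inf_adherent e0 Sinf.
have {}hte : h t < y + e by [].
have ft0 := f_pos t; have yht := yh t; have ht := hE t.
have qt0 := sqdist_ge0 x t; have DPt := DP t.
have fh : f t <= 4 * y by nra.
have : g <= 2 * f t * (h t - y) by rewrite /g; nra.
nra.
Qed.

Lemma equidistant_function_spec : 0 < equidistant_function f x /\
  dist_to_set (graph_point x (equidistant_function f x)) (graph_of f)
    = equidistant_function f x.
Proof.
have [G0 GE] := xgetPex 0 equidistant_point_exists.
by split=> //; rewrite {1}/equidistant_function GE dist_horizontal // ltW.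
Qed.

Lemma equidistant_function_gt0 : 0 < equidistant_function f x.
Proof. by have [] := equidistant_function_spec. Qed.

(** Shrinking the radius keeps the linear condition since [f] is positive; conversely, a larger
    avoiding ball would make the distance at the equidistant point too big. *)
Lemma le_equidistant_function y : 0 < y ->
  y <= equidistant_function f x <-> ball_avoids_graph f x y.
Proof.
move=> y0; have [G0 GE] := equidistant_function_spec; split=> [yG|yP].
  have /ball_avoids_graphE GP :
      ball_avoids_graph f x (equidistant_function f x).
    by apply: (iffLR (le_dist_graph f x _ (ltW G0))); rewrite GE.
  by apply/ball_avoids_graphE => t; have := GP t; have := f_pos t; nra.
rewrite leNgt; apply/negP => Gy.
by have := dist_graph_gt G0 Gy yP; rewrite GE ltxx.
Qed.

End Fixed.

Lemma sqdist_segment x t (s : R) :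
  sqdist x (x + s *: (t - x)) = s ^+ 2 * sqdist x t.
Proof.
by rewrite /sqdist mulr_sumr; apply: eq_bigr => k _; rewrite !mxE; ring.
Qed.

Lemma ball_avoids_graph_monotone f g x y : continuous f ->
  (forall t, 0 < f t) -> (forall t, f t <= g t) -> 0 < y ->
  ball_avoids_graph f x y -> ball_avoids_graph g x y.
Proof.
move=> fc f_pos fg y0 fP t; rewrite leNgt; apply/negP => gin.
have qt0 := sqdist_ge0 x t.
have fx : y <= f x.
  have /ball_avoids_graphE/(_ x) := fP.
  by rewrite sqdistxx add0r expr2 ler_pM2r // => ?; lra.
have ft : f t <= y.
  (* If [y < f t <= g t], then [(t, f t)] is at least as close to the centre as [(t, g t)], hence
     inside the ball. *)
  rewrite leNgt; apply/negP => yf; have := fP t; have := fg t; nra.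
pose phi (s : R) := f (x + s *: (t - x)).
have phic : continuous phi.
  move=> s; apply: continuous_comp; last exact: fc.
  by apply: cvgD; [exact: cvg_cst | apply: cvgZr_tmp; exact: cvg_id].
have [|s /[!in_itv]/= /andP[s0 s1] phis] :=
    IVT (v := y) ler01 (continuous_subspaceT phic).
  by rewrite /phi scale0r addr0 scale1r addrC subrK ge_min ft orbT le_max fx.
(* The crossing point has height [y] and is horizontally no farther from [x] than [t], so it lies
   inside the ball. *)
have := fP (x + s *: (t - x));
rewrite sqdist_segment -/(phi s) phis subrr expr0n addr0.
have : s ^+ 2 * sqdist x t <= sqdist x t by rewrite ler_piMl // expr_le1.
have := sqr_ge0 (y - g t); lra.
Qed.

Lemma equidistant_function_monotone f g x : continuous f -> continuous g ->
  (forall t, 0 < f t) -> (forall t, f t <= g t) ->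
  equidistant_function f x <= equidistant_function g x.
Proof.
move=> fc gc f_pos fg.
have g_pos t : 0 < g t by exact: lt_le_trans (f_pos t) (fg t).
have G0 := equidistant_function_gt0 f_pos (fc x).
apply/le_equidistant_function => //; first exact: gc.
apply: (ball_avoids_graph_monotone fc) => //.
by apply/le_equidistant_function => //; exact: fc.
Qed.

End Equidistant.

Lemma continuous_bigmin (R : realType) (T : topologicalType) (I : Type)
    (r : seq I) (g : T -> R) (f : I -> T -> R) : continuous g ->
  (forall i, continuous (f i)) ->
  continuous (fun t => \big[Num.min/g t]_(i <- r) f i t).
Proof.
move=> gc fc; elim: r => [|i r IHr] t.
  by under eq_fun do rewrite big_nil; exact: gc.
under eq_fun do rewrite big_cons.
by apply: (continuous_min (f := f i)); [exact: fc | exact: IHr].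
Qed.

Theorem theorem1 (R : realType) (n : nat) (I : finType) (i0 : I)
    (f : I -> 'rV[R]_n -> R)
    (f_pos : forall (i : I) (t : 'rV[R]_n), 0 < f i t)
    (f_cont : forall i : I, continuous (f i))
    (x : 'rV[R]_n) :
  equidistant_function (fun t => \big[Num.min/f i0 t]_(i : I) f i t) x
  = \big[Num.min/equidistant_function (f i0) x]_(i : I)
      equidistant_function (f i) x.
Proof.
set fm := fun t => _; set m := \big[_/_]_(_ : I) _.
have fm_cont : continuous fm by exact: continuous_bigmin.
have fm_pos t : 0 < fm t by apply: lt_bigmin.
have G0 i := equidistant_function_gt0 (f_pos i) (f_cont i x).
have m0 : 0 < m by apply: lt_bigmin.
have fm_le i : equidistant_function fm x <= equidistant_function (f i) x.
  by apply: equidistant_function_monotone => // t; exact: bigmin_le.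
apply/eqP; rewrite eq_le; apply/andP; split; first exact: le_bigmin.
apply/le_equidistant_function => // [|t]; first exact: fm_cont.
have [i fmi] : exists i, fm t = f i t.
  have /bigmin_leP[fi|[i _ fi]] := lexx (fm t); [exists i0 | exists i].
    by apply/eqP; rewrite eq_le fi bigmin_le.
  by apply/eqP; rewrite eq_le fi bigmin_le.
(* With [i] fixed, the inequality is proved for all [t]: it then says that the ball of radius [m]
   avoids the graph of [f i]. *)
rewrite fmi; move: t {fmi}.
apply/(le_equidistant_function (f_pos i) (f_cont i x) m0).
exact: bigmin_le.
Qed.
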